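(* Let $G=(V,E)$ be a finite, connected graph with $V=[m]$. Then there is a closed interval $\mathcal J=\mathcal J(G)\subset\mathbb R^m$, depending only on $G$, such that, for the graph-based Pólya's urn on $G$ with any initial numbers of balls $B_1(0),\ldots,B_m(0)\ge 1$, the vector of proportions $x(n)=(x_1(n),\ldots,x_m(n))$ converges, as $n\to\infty$, to a (possibly random) point of $\mathcal J$ almost surely. Moreover, if $G$ is not balanced bipartite, then $\mathcal J$ is a singleton.
   Context: Let $G=(V,E)$ be a finite connected (simple, undirected) graph with $V=[m]=\{1,\ldots,m\}$ and $|E|=N$. Bipartite graphs. $G$ is bipartite if there is a partition $V=A\cup B$ (with $A$, $B$ disjoint) such that for every $\{i,j\}\in E$ either $i\in A, j\in B$ or $i\in B, j\in A$. If $\#A=\#B$, $G$ is called balanced bipartite; if $\#A\neq\#B$, $G$ is called unbalanced bipartite. Thus ''not balanced bipartite'' means that $G$ is either not bipartite or unbalanced bipartite. Graph-based Pólya's urn (linear case). Place a bin at each vertex $i\in[m]$, containing initially an integer number $B_i(0)\ge 1$ of balls. Let $B_i(n)$ be the number of balls in bin $i$ after step $n$. At step $n\ge 1$, for each edge $\{i,j\}\in E$ one ball is added either to bin $i$ or to bin $j$ (so that $N$ balls in total are added at each step), and, conditionally on the process up to step $n-1$, the probability that the ball of the edge $\{i,j\}$ is added to $i$ is $$\frac{B_i(n-1)}{B_i(n-1)+B_j(n-1)}.$$ Proportions. Let $N_0=\sum_{i=1}^m B_i(0)$, let $x_i(n)=\frac{B_i(n)}{N_0+nN}$ for $i\in[m]$,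 and let $x(n)=(x_1(n),\ldots,x_m(n))\in\mathbb R^m$. Closed interval. A closed interval in $\mathbb R^m$ means a closed line segment $\{(1-t)p+tq: t\in[0,1]\}$ with $p,q\in\mathbb R^m$; the case $p=q$ (a single point) is allowed. The limit point in $\mathcal J$ may depend on the realization of the process. *)

(* Defs.v *)
From HB Require Import structures.
From mathcomp Require Import all_boot all_order all_algebra.
From mathcomp Require Import all_classical all_reals all_analysis.

Set Implicit Arguments.
Unset Strict Implicit.
Unset Printing Implicit Defensive.

Import Order.TTheory GRing.Theory Num.Theory.
Import numFieldNormedType.Exports.

Local Open Scope classical_set_scope.
Local Open Scope ring_scope.

Definition simple_graph (m : nat) (e : rel 'I_m) : Prop :=
  symmetric e /\ irreflexive e.

Definition connected_graph (m : nat) (e : rel 'I_m) : Prop :=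
  (0 < m)%N /\ forall i j : 'I_m, connect e i j.

(* In a simple graph, each edge {i, j} is counted once, as the pair i < j. *)
Definition num_edges (m : nat) (e : rel 'I_m) : nat :=
  #|[set p : 'I_m * 'I_m | (p.1 < p.2)%N && e p.1 p.2]%SET|.

Definition bipartition (m : nat) (e : rel 'I_m) (A B : {set 'I_m}) : Prop :=
  [/\ A :|: B = [set: 'I_m]%SET, [disjoint A & B]%bool &
      forall i j : 'I_m, e i j ->
        (i \in A /\ j \in B) \/ (i \in B /\ j \in A)].

Definition balanced_bipartite (m : nat) (e : rel 'I_m) : Prop :=
  exists A B : {set 'I_m}, bipartition e A B /\ #|A| = #|B|.

(* Only used with P H != 0 *)
Definition cond_prob (R : realType) (d : measure_display)
    (T : measurableType d) (P : probability T R) (A H : set T) : R :=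
  fine (P (A `&` H)) / fine (P H).

Definition history (m : nat) (T : Type) (B : nat -> 'I_m -> T -> nat) (n : nat)
    (h : nat -> 'I_m -> nat) : set T :=
  [set w | forall k i, (k <= n)%N -> B k i w = h k i].

(* [B n i] is the number of balls in bin [i] after step [n], and [won n i j]
   says that at step [n.+1] the ball of the edge {i, j} is added to bin [i].
   The past up to step [n] takes countably many values, so conditioning on it
   is elementary conditioning on the histories of positive probability.
   No joint law is imposed on the choices that distinct edges make in the same
   step: only the conditional probability of each choice is prescribed. *)
Record polya_urn (R : realType) (m : nat) (e : rel 'I_m) (B0 : 'I_m -> nat)
    (d : measure_display) (T : measurableType d) (P : probability T R)
    (B : nat -> 'I_m -> T -> nat) (won : nat -> 'I_m -> 'I_m -> T -> bool)
    : Prop := PolyaUrn {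
  urn_init : forall i w, B 0%N i w = B0 i ;
  urn_measurable : forall n i j, e i j ->
    measurable [set w | won n i j w] ;
  urn_one_ball : forall n i j w, e i j -> won n j i w = ~~ won n i j w ;
  urn_step : forall n i w,
    B n.+1 i w = (B n i w + \sum_(j < m | e i j) won n i j w)%N ;
  urn_law : forall n i j (h : nat -> 'I_m -> nat), e i j ->
    P (history B n h) != 0%E ->
    cond_prob P [set w | won n i j w] (history B n h) =
      (h n i)%:R / ((h n i)%:R + (h n j)%:R)
}.

Definition proportions (R : realType) (m : nat) (e : rel 'I_m)
    (B0 : 'I_m -> nat) (T : Type) (B : nat -> 'I_m -> T -> nat)
    (w : T) (n : nat) : 'rV[R]_m :=
  \row_(i < m) ((B n i w)%:R / (\sum_(k < m) B0 k + n * num_edges e)%:R).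

Definition closed_interval (R : realType) (m : nat) (J : set 'rV[R]_m) : Prop :=
  exists p q : 'rV[R]_m,
    J = [set z | exists2 t : R, 0 <= t <= 1 & z = (1 - t) *: p + t *: q].

(* Main.v *)
Require Import Defs.
From HB Require Import structures.
From mathcomp Require Import all_boot all_order all_algebra.
From mathcomp Require Import all_classical all_reals all_analysis.
From mathcomp Require Import measurable_realfun ring lra zify.

Set Implicit Arguments.
Unset Strict Implicit.
Unset Printing Implicit Defensive.

Import Order.TTheory GRing.Theory Num.Theory.
Import numFieldNormedType.Exports.

Local Open Scope classical_set_scope.
Local Open Scope ring_scope.

(** Let [x(n)] be the vector of proportions, [S(n)] the total number of balls
    and [N] the number of edges.  Up to smaller terms, the expected increment of
    [x_i] is [x_i dL/dx_i (x) / S(n)], where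
    [L(x) = sum_(ij edge) ln (x_i + x_j) - N sum_i x_i]
    is concave.  The interval is the set of maximisers of [L] on the simplex,
    which is defined here by its first-order conditions ([equilibria]); it is
    non-empty by compactness ([equilibria_nonempty]).  As [L] is strictly
    concave in the edge sums [x_i + x_j], these sums take the same values at all
    equilibria ([equilibria_edge_sum]).  Hence the difference of two equilibria
    changes sign along every edge and, the graph being connected, has constant
    absolute value.  Its entries sum to 0, so it vanishes unless the graph is
    balanced bipartite, and then its direction is determined by the two sides
    ([equilibria_unique], [equilibria_interval]).

    For the convergence, fix an equilibrium [v] and follow
    [sum_i v_i ln x_i(n)], that is, up to a constant, the opposite of the
    relative entropy of [v] with respect to [x(n)].  Up to convergent sequences,
    it is the sum over the past steps of its drift
    [<grad L(x), v> / S = <grad L(x), v - x> / S], which concavity makes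
    non-negative; quantitatively it is at least the squared distance of the
    edge sums of [x] to those of [v], divided by [S] ([equilibria_ratio_ge]).
    Two facts reduce the dynamics to that drift:
    - the second-order error in [ln B_i(n+1) - ln B_i(n)] telescopes against
      [1 / B_i(n)] ([cvg_ln_sub_series]);
    - the noise, that is the relative gain of a bin minus its conditional mean,
      is a martingale difference sequence whose second moments have a finite
      sum, again because the squared relative gains telescope, so that the
      noise series converges almost surely ([noise_cvg]).

    The rest is deterministic ([proportions_cvg]).  As [sum_i v_i ln x_i(n)] is
    at most 0, the drift is summable and this sum converges.  Since the sum of
    the [1 / S(n)] diverges, the edge sums of [x(n)] come arbitrarily close to
    those of the equilibria infinitely often, and by compactness [x(n)] has a
    cluster point [z] that is an equilibrium.  Now take [v := z]: the sequence
    [sum_i z_i ln x_i(n)] converges, and its limit can only be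
    [sum_i z_i ln z_i], so the relative entropy of [z] with respect to [x(n)]
    tends to 0 and [x(n)] tends to [z].  The choice of [v] after the cluster
    point is what yields a single limit also when there is a whole segment of
    equilibria. *)

(** * Equilibria of the mean dynamics *)

Section Equilibria.
Variables (R : realType) (m : nat) (e : rel 'I_m).
Hypothesis simple_e : simple_graph e.

Definition edges : {set 'I_m * 'I_m} :=
  [set p : 'I_m * 'I_m | (p.1 < p.2)%N && e p.1 p.2]%SET.

Definition edge_sum (x : 'rV[R]_m) (p : 'I_m * 'I_m) : R :=
  x ord0 p.1 + x ord0 p.2.

Definition edge_gap (v x : 'rV[R]_m) : R :=
  \sum_(p in edges) (edge_sum x p - edge_sum v p) ^+ 2.

Definition simplex : set 'rV[R]_m :=
  [set x | (forall i, 0 <= x ord0 i) /\ \sum_i x ord0 i = 1].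

(** The last clause is the first-order condition, in the direction of the i-th
    vertex of the simplex, for a maximum of the product of the edge sums. *)
Definition equilibria : set 'rV[R]_m :=
  [set v | [/\ simplex v,
     forall i j, e i j -> 0 < v ord0 i + v ord0 j &
     forall i, \sum_(j | e i j) (v ord0 i + v ord0 j)^-1 <= (num_edges e)%:R]].

Lemma edges_sym_ind (Q : 'I_m -> 'I_m -> Prop) :
  (forall i j, Q i j -> Q j i) -> (forall p, p \in edges -> Q p.1 p.2) ->
  forall i j, e i j -> Q i j.
Proof.
have [se ie] := simple_e => Qs Qe i j eij.
case: (ltngtP i j) => [ij|ij|/val_inj ij].
- by apply: (Qe (i, j)); rewrite inE /= ij.
- by apply: Qs; apply: (Qe (j, i)); rewrite inE /= ij se.
- by rewrite ij ie in eij.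
Qed.

Lemma sum_over_edges (V : nmodType) (F : 'I_m -> 'I_m -> V) :
  \sum_i \sum_(j | e i j) F i j =
  \sum_(p in edges) (F p.1 p.2 + F p.2 p.1).
Proof.
have [se ie] := simple_e.
rewrite (pair_big_dep predT (fun i j => e i j)) /=.
rewrite (bigID (fun p : 'I_m * 'I_m => (p.1 < p.2)%N)) /= big_split /=.
congr (_ + _); first by apply: eq_bigl => p; rewrite inE andbC.
have swapK : involutive (fun p : 'I_m * 'I_m => (p.2, p.1)) by case.
rewrite (reindex_inj (inv_inj swapK)) /=.
apply: eq_bigl => p; rewrite inE se andbC -leqNgt leq_eqVlt.
case: eqP => [/val_inj ->|_] /=; first by rewrite ie ltnn.
by rewrite andbC.
Qed.

Lemma edge_sum_ge0 x p : simplex x -> 0 <= edge_sum x p.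
Proof. by case=> x0 _; rewrite addr_ge0. Qed.

Lemma edge_sum_le1 x p : simplex x -> p \in edges -> edge_sum x p <= 1.
Proof.
case=> x0 <-; rewrite inE => /andP[/ltn_eqF p12 _].
rewrite (bigD1 p.1) //= (bigD1 p.2) /=; last first.
  by apply/eqP => E; rewrite E eqxx in p12.
by rewrite addrA lerDl sumr_ge0.
Qed.

Lemma edge_sum_gt0 (x : 'rV[R]_m) p :
  (forall i j, e i j -> 0 < x ord0 i + x ord0 j) -> p \in edges -> 0 < edge_sum x p.
Proof. by move=> x0; rewrite inE => /andP[_ /x0]. Qed.

Lemma edge_ratioE (x v : 'rV[R]_m) :
  \sum_(p in edges) edge_sum x p / edge_sum v p =
  \sum_i x ord0 i * \sum_(j | e i j) (v ord0 i + v ord0 j)^-1.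
Proof.
under [RHS]eq_bigr do rewrite mulr_sumr.
rewrite sum_over_edges; apply: eq_bigr => p _.
by rewrite /edge_sum [v ord0 p.2 + _]addrC mulrDl.
Qed.

(** This is [<grad L(v), x - v> <= 0] for the concave function [L] above. *)
Lemma equilibria_ratio v x : equilibria v -> simplex x ->
  \sum_(p in edges) edge_sum x p / edge_sum v p <= (num_edges e)%:R.
Proof.
move=> [_ _ vN] [x0 x1]; rewrite edge_ratioE.
rewrite -[leRHS]mul1r -[X in X * _]x1 mulr_suml; apply: ler_sum => i _.
exact: ler_wpM2l.
Qed.

(** This is [<grad L(x), v - x> >= 0] with a quantitative remainder.  It follows
    from the inequality at [v] because [a / b + b / a >= 2 + (a - b)^2] for the
    two sums [a], [b] of an edge, which are positive and at most 1. *)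
Lemma equilibria_ratio_ge v x : equilibria v -> simplex x ->
  (forall i j, e i j -> 0 < x ord0 i + x ord0 j) ->
  (num_edges e)%:R + edge_gap v x <=
  \sum_(p in edges) edge_sum v p / edge_sum x p.
Proof.
move=> Jv Sx x0; have [Sv v0 _] := Jv.
have H p : p \in edges -> 2 + (edge_sum x p - edge_sum v p) ^+ 2 <=
    edge_sum v p / edge_sum x p + edge_sum x p / edge_sum v p.
  move=> pe; have := edge_sum_gt0 x0 pe; have := edge_sum_gt0 v0 pe.
  have := edge_sum_le1 Sx pe; have := edge_sum_le1 Sv pe.
  move: (edge_sum x p) (edge_sum v p) => a b b1 a1 b0 a0.
  have -> : b / a + a / b = 2 + (a - b) ^+ 2 / (a * b).
    by field; rewrite !gt_eqF.
  rewrite lerD2l ler_pdivlMr ?mulr_gt0// ler_piMr ?sqr_ge0//.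
  by apply: mulr_ile1 => //; apply: ltW.
have : \sum_(p in edges) (2 + (edge_sum x p - edge_sum v p) ^+ 2) <=
    \sum_(p in edges) (edge_sum v p / edge_sum x p + edge_sum x p / edge_sum v p).
  exact: ler_sum.
rewrite !big_split /= sumr_const -/edges.
have := equilibria_ratio Jv Sx; have -> : num_edges e = #|edges| by [].
rewrite /edge_gap; set s1 := \sum_(i in _) _; set s2 := \sum_(i in _) _.
set s3 := \sum_(i in _) _.
lra.
Qed.

Lemma edge_gap_ge0 v x : 0 <= edge_gap v x.
Proof. by apply: sumr_ge0 => p _; rewrite sqr_ge0. Qed.

Lemma edge_gap_eq0 v x : edge_gap v x = 0 ->
  forall i j, e i j -> x ord0 i + x ord0 j = v ord0 i + v ord0 j.
Proof.
move=> /eqP; rewrite psumr_eq0 => [/allP h|p _]; last by rewrite sqr_ge0.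
apply: edges_sym_ind => [i j|p pe].
  by rewrite addrC => ->; rewrite addrC.
have := h p (mem_index_enum _); rewrite pe /= sqrf_eq0 subr_eq0.
by move=> /eqP.
Qed.

(** The derivative of [L] at [w] towards [v] is at most 0 because [w] is an
    equilibrium, and at least the edge gap because [v] is one. *)
Lemma equilibria_edge_sum v w : equilibria v -> equilibria w ->
  forall i j, e i j -> w ord0 i + w ord0 j = v ord0 i + v ord0 j.
Proof.
move=> Jv Jw; have [Sv _ _] := Jv; have [Sw w0 _] := Jw.
apply: edge_gap_eq0; apply/eqP; rewrite eq_le edge_gap_ge0 andbT.
have := equilibria_ratio_ge Jv Sw w0; have := equilibria_ratio Jw Sv.
lra.
Qed.

Lemma equilibria_transfer v w : equilibria v -> simplex w ->
  (forall i j, e i j -> w ord0 i + w ord0 j = v ord0 i + v ord0 j) ->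
  equilibria w.
Proof.
move=> [_ v0 vN] Sw wv; split=> // [i j eij|i]; first by rewrite wv// v0.
by rewrite (eq_bigr _ (fun j eij => congr1 GRing.inv (wv i j eij))).
Qed.

Lemma sum_coord_continuous : continuous (fun x : 'rV[R]_m => \sum_i x ord0 i).
Proof.
move=> x; apply: (@cvg_big _ _ _ _ _ add_continuous _ (nbhs x)) => i _.
exact: coord_continuous.
Qed.

Lemma simplex_compact : compact simplex.
Proof.
have Mco : compact [set v : 'rV[R]_m | forall i, v ord0 i \in `[(0 : R), 1]].
  by apply: (@rV_compact _ _ (fun=> `[(0 : R), 1]%classic)) => _; apply: segment_compact.
apply: subclosed_compact Mco _; last first.
  move=> x [x0 <-] i /=; rewrite in_itv /= x0 /= (bigD1 i) //= lerDl.
  by apply: sumr_ge0.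
have -> : simplex = (\bigcap_i [set x : 'rV[R]_m | 0 <= x ord0 i]) `&`
    [set x : 'rV[R]_m | \sum_i x ord0 i = 1].
  apply/seteqP; split=> x [x0 x1]; split=> // i; first by move=> _; apply: x0.
  exact: x0 i I.
apply: closedI.
  apply: closed_bigI => i _; apply: (@closed_comp _ _ _ [set t : R | 0 <= t]).
    by move=> x _; apply: coord_continuous.
  exact: closed_ge.
apply: (@closed_comp _ _ (fun x : 'rV[R]_m => \sum_i x ord0 i) [set t : R | t = 1]).
  by move=> x _; apply: sum_coord_continuous.
exact: closed_eq.
Qed.

(** A Bernoulli inequality with a second-order error: it bounds the
    derivative of the product at 0 without differentiating it. *)
Lemma prod_lower_bound (I : Type) (s : seq I) (P : pred I) (a : I -> R) :
  exists C, 0 <= C /\ forall t, 0 <= t <= 1 ->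
    (forall i, P i -> 0 <= 1 + t * a i) ->
    1 + t * \sum_(i <- s | P i) a i - C * t ^+ 2 <=
    \prod_(i <- s | P i) (1 + t * a i).
Proof.
elim: s => [|i s [C [C0 IH]]].
  by exists 0; split => // t _ _; rewrite !big_nil mulr0 mul0r addr0 subr0.
have [Pi|nPi] := boolP (P i); last first.
  by exists C; split => // t t01 h; rewrite !big_cons (negbTE nPi) IH.
set S := \sum_(i <- s | P i) a i in IH.
exists (`|a i * S| + C + C * `|a i|); split.
  by rewrite !addr_ge0 ?mulr_ge0.
move=> t t01 h; rewrite !big_cons Pi -/S.
apply: le_trans (ler_wpM2l (h i Pi) (IH t t01 h)).
have := ler_normlW (lexx `|- (a i * S)|); rewrite normrN.
have := ler_norm (a i); move: (normr_ge0 (a i)).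
move: (a i) => b; move: `|b| `|b * S| => b' bs' b'0 h1 h2.
have /andP[t0 t1] := t01.
have : t ^+ 2 * (bs' + b * S) + t ^+ 2 * (C * (b' - t * b)) >= 0.
  rewrite addr_ge0// mulr_ge0 ?sqr_ge0//; first lra.
  rewrite mulr_ge0// subr_ge0.
  have [b0|b0] := leP 0 b; first by nra.
  by nra.
lra.
Qed.

Hypothesis m_gt0 : (0 < m)%N.

Lemma simplex_uniform : simplex (const_mx m%:R^-1).
Proof.
split=> [i|]; first by rewrite mxE invr_ge0.
under eq_bigr do rewrite mxE.
by rewrite sumr_const card_ord -[LHS]mulr_natr mulVf// pnatr_eq0 -lt0n.
Qed.

Lemma simplex_delta i : simplex (delta_mx ord0 i).
Proof.
split=> [j|]; first by rewrite mxE eqxx.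
rewrite (bigD1 i) //= mxE !eqxx big1 ?addr0// => j /negbTE ji.
by rewrite mxE ji andbF.
Qed.

Lemma simplex_convex (t : R) x y : 0 <= t <= 1 -> simplex x -> simplex y ->
  simplex ((1 - t) *: x + t *: y).
Proof.
move=> /andP[t0 t1] [x0 x1] [y0 y1]; split=> [i|].
  by rewrite !mxE addr_ge0 ?mulr_ge0// subr_ge0.
under eq_bigr do rewrite !mxE.
by rewrite big_split /= -!mulr_sumr x1 y1 !mulr1 subrK.
Qed.

(** A maximiser of the product of the edge sums is an equilibrium: moving from it
    towards a vertex of the simplex cannot increase the product. *)
Lemma equilibria_nonempty : equilibria !=set0.
Proof.
pose f (x : 'rV[R]_m) := \prod_(p in edges) edge_sum x p.
have [v /set_mem Sv vmax] : exists2 v, v \in simplex &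
    forall x, x \in simplex -> f x <= f v.
  apply: compact_EVT_max; [|exact: simplex_compact|].
    by eexists; exact: simplex_uniform.
  apply: continuous_subspaceT => x.
  apply: (@cvg_big _ _ _ _ _ mul_continuous _ (nbhs x)) => p _.
  by apply: cvgD; apply: coord_continuous.
have fv0 : 0 < f v.
  apply: lt_le_trans (vmax _ (mem_set simplex_uniform)).
  apply: prodr_gt0 => p _; rewrite /edge_sum !mxE.
  by rewrite addr_gt0// invr_gt0 ltr0n.
have v0 p : p \in edges -> 0 < edge_sum v p.
  move=> pe; rewrite lt_neqAle edge_sum_ge0// andbT eq_sym.
  by move: fv0; rewrite lt0r => /andP[/prodf_neq0 /(_ _ pe)].
exists v; split => //.
  by apply: edges_sym_ind => // i j; rewrite addrC.
move=> i; pose w : 'rV[R]_m := delta_mx ord0 i.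
have -> : \sum_(j | e i j) (v ord0 i + v ord0 j)^-1 =
    \sum_(p in edges) edge_sum w p / edge_sum v p.
  rewrite edge_ratioE [RHS](bigD1 i) //= mxE !eqxx mul1r.
  by rewrite [X in _ + X]big1 ?addr0// => j /negbTE ji; rewrite mxE ji andbF mul0r.
(* [a p] is the logarithmic derivative of the edge sum of [p] along the segment
   from [v] to [w]. *)
pose a p := edge_sum w p / edge_sum v p - 1.
suff : \sum_(p in edges) a p <= 0.
  by rewrite sumrB sumr_const subr_le0.
have xtE t p : p \in edges ->
    edge_sum ((1 - t) *: v + t *: w) p = edge_sum v p * (1 + t * a p).
  move=> pe; have := v0 p pe; rewrite /a /edge_sum !mxE => vp.
  by field; rewrite gt_eqF.
have [C [C0 HC]] := prod_lower_bound (index_enum _) (mem edges) a.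
have H t : 0 < t <= 1 -> \sum_(p in edges) a p <= C * t.
  move=> /andP[t0 t1]; have t01 : 0 <= t <= 1 by rewrite ltW.
  have St := simplex_convex t01 Sv (simplex_delta i).
  have := HC t t01; have -> : \prod_(p in edges) (1 + t * a p) =
      f ((1 - t) *: v + t *: w) / f v.
    rewrite /f (eq_bigr _ (xtE t)) big_split /= mulrAC divff ?mul1r// gt_eqF//.
  have : f ((1 - t) *: v + t *: w) / f v <= 1.
    by rewrite ler_pdivrMr// mul1r vmax//; apply: mem_set.
  move=> h1 /(_ _)/le_trans/(_ h1) h2.
  have {}h2 : 1 + t * (\sum_(p in edges) a p) - C * t ^+ 2 <= 1.
    apply: h2 => p pe; have := edge_sum_ge0 p St; rewrite xtE//.
    by rewrite pmulr_rge0// v0.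
  rewrite -(ler_pM2l t0); lra.
rewrite leNgt; apply/negP => S0.
set S := \sum_(p in edges) a p in H S0.
(* At this time the error [C * t] is less than the positive slope [S]. *)
have := H (Num.min 1 (S / (2 * (C + 1)))).
have C1 : 0 < 2 * (C + 1) by lra.
rewrite lt_min ltr01 divr_gt0// ge_min lexx /= => /(_ isT).
have /(ler_wpM2l C0) : Num.min 1 (S / (2 * (C + 1))) <= S / (2 * (C + 1)).
  by rewrite ge_min lexx orbT.
have : C * (S / (2 * (C + 1))) < S.
  by rewrite mulrA ltr_pdivrMr//; nra.
lra.
Qed.

Hypothesis connected_e : forall i j : 'I_m, connect e i j.

Lemma edge_invariant_const (T : eqType) (f : 'I_m -> T) :
  (forall i j, e i j -> f i = f j) -> forall i j, f i = f j.
Proof.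
move=> fe i j; have fc : fingraph.closed e [pred k | f i == f k].
  by move=> k l /fe kl; rewrite !inE kl.
by have := closed_connect fc (connected_e i j); rewrite !inE eqxx => /esym/eqP.
Qed.

(** If [v <> w], the coordinates where [w - v] is positive and those where it is
    negative form a bipartition, balanced because [w - v] has constant absolute
    value and sum 0. *)
Lemma equilibria_unique v w : ~ balanced_bipartite e ->
  equilibria v -> equilibria w -> v = w.
Proof.
move=> nb Jv Jw; apply: contrapT => vw; apply: nb.
pose u i : R := w ord0 i - v ord0 i.
have ue i j : e i j -> u i = - u j.
  by move=> eij; have := equilibria_edge_sum Jv Jw eij; rewrite /u; lra.
have u0 : \sum_i u i = 0.
  have [[_ v1] _ _] := Jv; have [[_ w1] _ _] := Jw.
  by rewrite sumrB v1 w1 subrr.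
have uc : forall i j, `|u i| = `|u j|.
  by apply: edge_invariant_const => i j /ue ->; rewrite normrN.
have [k uk] : exists k, u k != 0.
  apply: contrapT => /forallNP h; apply: vw; apply/rowP => i.
  by have /negP/negPn := h i; rewrite subr_eq0 eq_sym => /eqP.
have un i : u i != 0 by rewrite -normr_eq0 (uc i k) normr_eq0.
pose A := [set i | 0 < u i]%SET; exists A, (~: A); split; first split.
- by rewrite finset.setUCr.
- by rewrite -finset.setI_eq0 finset.setICr.
- move=> i j eij; rewrite !inE (ue i j eij) oppr_gt0.
  by case: ltgtP (un j) => // _ _; [left|right].
have H (i : 'I_m) : u i = (i \in A)%:R * `|u k| - (i \notin A)%:R * `|u k|.
  rewrite -(uc i k) inE; case: ltgtP (un i) => //= ui _.
    by rewrite gtr0_norm// mul1r mul0r subr0.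
  by rewrite ltr0_norm// mul1r mul0r sub0r opprK.
move: u0; rewrite (eq_bigr _ (fun i _ => H i)) sumrB -!mulr_suml -mulrBl => /eqP.
rewrite mulf_eq0 normr_eq0 (negbTE uk) orbF -!natr_sum subr_eq0 eqr_nat.
rewrite -!big_mkcond /= !sum1_card => /eqP ->; apply: eq_card => i.
by rewrite finset.in_setC.
Qed.

(** In the balanced bipartite case the equilibria are the points [v + c s], with
    [s] the signs of the two sides, that have non-negative coordinates; the
    extreme values of [c] are given by the least coordinates of [v] on each
    side. *)
Lemma equilibria_interval : closed_interval equilibria.
Proof.
have [v Jv] := equilibria_nonempty.
have [|nb] := pselect (balanced_bipartite e); last first.
  exists v, v; apply/seteqP; split=> [w Jw|w [t _ ->]].
    by exists 0; rewrite ?lexx ?ler01// -(equilibria_unique nb Jv Jw)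
      subr0 scale1r scale0r addr0.
  by rewrite -scalerDl subrK scale1r.
move=> [A [B [[AB /pred0P dAB eAB] cAB]]].
have inB i : (i \in B) = (i \notin A).
  have := dAB i; have : i \in A :|: B by rewrite AB inE.
  by rewrite /= inE; case: (i \in A) => //=; case: (i \in B).
have A0 : (0 < #|A|)%N.
  rewrite lt0n; apply/negP => A0; move: (A0); rewrite cAB => B0.
  have := cardsUI A B; rewrite AB cardsT card_ord (eqP A0) (eqP B0) addn0 => m0.
  by move: m_gt0; rewrite -[m](addnK #|A :&: B|) m0 sub0n.
have /card_gt0P[i0 i0A] := A0; have /card_gt0P[j0 j0B] : (0 < #|B|)%N by rewrite -cAB.
pose s (i : 'I_m) : R := if i \in A then 1 else - 1.
have se i j : e i j -> s i = - s j.
  by move=> /eAB [] [iA jB]; rewrite /s; move: iA jB; rewrite !inB;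
    [move=> ->|move=> /[swap] ->] => /negbTE -> //; rewrite opprK.
have s2 i : s i * s i = 1 by rewrite /s; case: ifP => _; rewrite ?mulrNN mulr1.
have s0 : \sum_i s i = 0.
  rewrite (bigID (mem A)) /= (eq_bigr (fun=> 1)); last by move=> i iA; rewrite /s iA.
  rewrite [X in _ + X](eq_bigr (fun=> - 1)); last by move=> i /negbTE iA; rewrite /s iA.
  rewrite sumrN !sumr_const cAB; apply/eqP; rewrite subr_eq0 eqr_nat; apply/eqP.
  by apply: eq_card => i; rewrite [LHS]inB.
pose iA := [arg min_(i < i0 in A) v ord0 i]%O.
pose iB := [arg min_(i < j0 in B) v ord0 i]%O.
have [[v0 v1] _ _] := Jv.
have JE w : equilibria w <->
    exists2 c, - v ord0 iA <= c <= v ord0 iB & w = v + c *: \row_i s i.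
  split=> [Jw|[c /andP[c1 c2] ->]].
    pose c := (w ord0 i0 - v ord0 i0) * s i0.
    have cE i : (w ord0 i - v ord0 i) * s i = c.
      apply: (edge_invariant_const (f := fun i => (w ord0 i - v ord0 i) * s i)).
      move=> {}i j eij; have := equilibria_edge_sum Jv Jw eij; rewrite (se i j eij).
      by move=> h; rewrite mulrN -mulNr; congr (_ * _); lra.
    have wE i : w ord0 i = v ord0 i + c * s i.
      by rewrite -(cE i) -mulrA s2 mulr1 addrC subrK.
    have [[w0 _] _ _] := Jw.
    exists c; last by apply/rowP => i; rewrite !mxE wE.
    have iAA : iA \in A by rewrite /iA; case: arg_minP.
    have iBB : iB \in B by rewrite /iB; case: arg_minP.
    have := w0 iA; have := w0 iB; rewrite !wE /s iAA.
    by move: iBB; rewrite inB => /negbTE -> h1 h2; apply/andP; split; lra.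
  have e1 i j : e i j -> (v + c *: \row_i s i) ord0 i +
      (v + c *: \row_i s i) ord0 j = v ord0 i + v ord0 j.
    by move=> eij; rewrite !mxE (se i j eij); lra.
  apply: equilibria_transfer Jv _ e1; split => [i|]; last first.
    under eq_bigr do rewrite !mxE.
    by rewrite big_split /= v1 -mulr_sumr s0 mulr0 addr0.
  rewrite !mxE /s; case: ifPn => iAA.
    have : v ord0 iA <= v ord0 i by rewrite /iA; case: arg_minP => // k _; apply.
    lra.
  have : v ord0 iB <= v ord0 i.
    by rewrite /iB; case: arg_minP => // k _; apply; rewrite inB.
  lra.
set a := v ord0 iA in JE; set b := v ord0 iB in JE.
have a0 : 0 <= a by exact: v0.
have b0 : 0 <= b by exact: v0.
exists (v - a *: \row_i s i), (v + b *: \row_i s i).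
have zE (t : R) : (1 - t) *: (v - a *: \row_i s i) + t *: (v + b *: \row_i s i) =
    v + (t * (a + b) - a) *: \row_i s i.
  by apply/rowP => i; rewrite !mxE; ring.
apply/seteqP; split=> [w /JE[c cab ->]|w [t t01 ->]].
  have [ab0|ab0] := eqVneq (a + b) 0.
    exists 0; first by rewrite lexx ler01.
    by rewrite zE; congr (_ + _ *: _); lra.
  have ab : 0 < a + b by rewrite lt0r ab0 addr_ge0.
  exists ((c + a) / (a + b)); last by rewrite zE divfK// addrK.
  by rewrite divr_ge0 ?ler_pdivrMr//; lra.
by apply/JE; exists (t * (a + b) - a) => //; apply/andP; split; nra.
Qed.

End Equilibria.

(** * Real sequences and logarithms *)

Section RealSequences.
Variable R : realType.

Lemma cvgn_sum (I : Type) (r : seq I) (P : pred I) (f : I -> R ^nat) :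
  (forall i, P i -> cvgn (f i)) -> cvgn (fun n => \sum_(i <- r | P i) f i n).
Proof.
move=> cf; elim: r => [|i r IH].
  by under eq_fun do rewrite big_nil; apply: is_cvg_cst.
have [Pi|/negbTE nPi] := boolP (P i).
  by under eq_fun do rewrite big_cons Pi; apply: is_cvgD => //; apply: cf.
by under eq_fun do rewrite big_cons nPi.
Qed.

Lemma cvg_rowP (m : nat) (x : nat -> 'rV[R]_m) (z : 'rV[R]_m) :
  (forall i, x n ord0 i @[n --> \oo] --> z ord0 i) -> x n @[n --> \oo] --> z.
Proof.
move=> h; apply/cvg_ballP => eps eps0.
have : \forall n \near \oo, forall i, ball (z ord0 i) eps (x n ord0 i).
  by apply: filter_forall => i; have /cvg_ballP := h i; apply.
apply: filterS => n hn; split=> // i j.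
by rewrite (ord1 i); apply: hn.
Qed.

Lemma cluster_continuous_lim (T : topologicalType) (x : nat -> T) (z : T)
    (g : T -> R) (l : R) :
  cluster (x @ \oo) z -> {for z, continuous g} ->
  g (x n) @[n --> \oo] --> l -> g z = l.
Proof.
move=> xz gz gl; apply/eqP; rewrite -subr_eq0 -normr_le0.
apply/ler_addgt0Pl => eps eps0; rewrite addr0.
have e2 : 0 < eps / 2 by rewrite divr_gt0.
have A : (x @ \oo) [set y | `|l - g y| < eps / 2].
  by have /cvgrPdist_lt/(_ _ e2) := gl.
have B : nbhs z [set y | `|g z - g y| < eps / 2].
  by have /cvgrPdist_lt/(_ _ e2) := gz.
have [y [/= ly zy]] := xz _ _ A B.
have -> : g z - l = (g z - g y) - (l - g y) by ring.
by apply: le_trans (ler_normB _ _) _; rewrite [leRHS]splitr ltW// ltrD.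
Qed.

Lemma ln_increment (b d : R) : 0 < b -> 0 <= d ->
  d / (b + d) <= ln (b + d) - ln b <= d / b.
Proof.
move=> b0 d0; have bd : 0 < b + d by rewrite ltr_wpDr.
apply/andP; split.
  rewrite -opprB lerNr -ln_div ?posrE//.
  have -> : b / (b + d) = 1 + (- (d / (b + d))) by field; rewrite gt_eqF.
  apply: le_ln1Dx; rewrite ltrN2 ltr_pdivrMr// mul1r; lra.
rewrite -ln_div ?posrE//.
have -> : (b + d) / b = 1 + d / b by field; rewrite gt_eqF.
by apply: le_ln1Dx; apply: lt_le_trans (divr_ge0 d0 (ltW b0)); rewrite ltrN10.
Qed.

(** The increment of [ln b] lies between [d / (b + d)] and [d / b], whose
    difference is at most [K (1 / b - 1 / (b + d))]: it telescopes, however slowly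
    [b] grows. *)
Lemma cvg_ln_sub_series (b d : R ^nat) (K : R) :
  (forall n, 0 < b n) -> (forall n, b n.+1 = b n + d n) ->
  (forall n, 0 <= d n <= K) ->
  cvgn (fun n => ln (b n) - series (fun k => d k / b k) n).
Proof.
move=> b0 bd dK; apply: nonincreasing_is_cvgn.
  apply/nonincreasing_seqP => n; have /andP[d0 _] := dK n.
  have /andP[_] := ln_increment (b0 n) d0.
  rewrite -bd seriesEnat /= big_nat_recr //=; lra.
exists (ln (b 0%N) - K / b 0%N) => _ [n _ <-].
suff : ln (b 0%N) - K / b 0%N + K / b n <= ln (b n) - series (fun k => d k / b k) n.
  apply: le_trans; rewrite lerDl; apply: divr_ge0; last exact: ltW.
  by have /andP[] := dK 0%N; apply: le_trans.
elim: n => [|n IH]; first by rewrite seriesEnat /= big_geq//; lra.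
have /andP[d0 dK'] := dK n.
have /andP[+ _] := ln_increment (b0 n) d0; rewrite -bd.
move: IH; rewrite !seriesEnat /= (big_nat_recr n) //=.
have : d n / b n - d n / b n.+1 <= K / b n - K / b n.+1.
  rewrite -!mulrBr ler_wpM2r// subr_ge0 lef_pV2 ?posrE// bd lerDl//.
lra.
Qed.

(** Summed over the coordinates of two points of the simplex, this bounds the
    squared Hellinger distance by the relative entropy. *)
Lemma ln_sqrt_ineq (z x : R) : 0 <= z -> 0 < x ->
  z * ln x <= z * ln z + 2 * (Num.sqrt x * Num.sqrt z - z).
Proof.
move=> z0 x0; have [->|zn0] := eqVneq z 0.
  by rewrite !mul0r sqrtr0 mulr0 subrr mulr0 addr0.
have {z0 zn0}z0 : 0 < z by rewrite lt0r zn0.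
have sx : 0 < Num.sqrt x by rewrite sqrtr_gt0.
have sz : 0 < Num.sqrt z by rewrite sqrtr_gt0.
rewrite -{1}(sqr_sqrtr (ltW x0)) -{1 2 3 5}(sqr_sqrtr (ltW z0)).
move: (Num.sqrt x) (Num.sqrt z) sx sz => a b a0 b0.
rewrite !lnXn// !mulr2n.
have : ln a - ln b <= a / b - 1.
  rewrite -ln_div ?posrE// -[X in ln X](subrK 1) addrC.
  by apply: le_ln1Dx; rewrite ltrBrDl addrN divr_gt0.
have b2 : 0 < b ^+ 2 by rewrite exprn_gt0.
rewrite -(ler_pM2l b2).
have -> : b ^+ 2 * (a / b - 1) = a * b - b ^+ 2 by field; rewrite gt_eqF.
lra.
Qed.

End RealSequences.

(** * Convergence along a trajectory with convergent noise *)

Section DeterministicConvergence.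
Variables (R : realType) (m : nat) (e : rel 'I_m).
Hypothesis simple_e : simple_graph e.

Lemma simplex_kl_cvg (x : nat -> 'rV[R]_m) (z : 'rV[R]_m) :
  simplex z -> (forall n, simplex (x n)) -> (forall n i, 0 < x n ord0 i) ->
  (\sum_i z ord0 i * ln (x n ord0 i)) @[n --> \oo] -->
     \sum_i z ord0 i * ln (z ord0 i) ->
  x n @[n --> \oo] --> z.
Proof.
move=> [z0 z1] Sx x0 kl; apply: cvg_rowP => i.
pose h n := \sum_i z ord0 i * ln (z ord0 i) - \sum_i z ord0 i * ln (x n ord0 i).
have h0 : h n @[n --> \oo] --> 0.
  rewrite -(subrr (\sum_i z ord0 i * ln (z ord0 i))).
  by apply: cvgB => //; apply: cvg_cst.
have hE n : (Num.sqrt (x n ord0 i) - Num.sqrt (z ord0 i)) ^+ 2 <= h n.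
  have [xn0 xn1] := Sx n.
  have sq j : (Num.sqrt (x n ord0 j) - Num.sqrt (z ord0 j)) ^+ 2 <=
      z ord0 j * ln (z ord0 j) - z ord0 j * ln (x n ord0 j)
      + x n ord0 j - z ord0 j.
    have := ln_sqrt_ineq (z0 j) (x0 n j).
    rewrite sqrrB sqr_sqrtr// sqr_sqrtr//; lra.
  apply: (@le_trans _ _ (\sum_j (Num.sqrt (x n ord0 j) - Num.sqrt (z ord0 j)) ^+ 2)).
    by rewrite (bigD1 i) //= lerDl sumr_ge0// => j _; rewrite sqr_ge0.
  apply: le_trans (ler_sum _ (fun j _ => sq j)) _.
  by rewrite !sumrB big_split /= sumrB xn1 z1 addrK.
have s0 : (Num.sqrt (x n ord0 i) - Num.sqrt (z ord0 i)) @[n --> \oo] --> 0.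
  apply/cvgr0Pnorm_lt => eps eps0.
  have /cvgr0Pnorm_lt /(_ _ (exprn_gt0 2 eps0)) := h0.
  apply: filterS => n hn; rewrite -(ltr_pXn2r (ltn0Sn 1)) ?nnegrE ?(ltW eps0)//.
  by rewrite real_normK ?num_real//; apply: le_lt_trans hn; apply: le_trans (ler_norm _).
have s1 : Num.sqrt (x n ord0 i) @[n --> \oo] --> Num.sqrt (z ord0 i).
  by apply: cvg_zero; exact: s0.
rewrite -(sqr_sqrtr (z0 i)) expr2.
under eq_fun do rewrite -(sqr_sqrtr (ltW (x0 _ i))) expr2.
exact: cvgM.
Qed.

Lemma edge_sum_continuous p : continuous (fun x : 'rV[R]_m => edge_sum x p).
Proof. by move=> x; apply: (@cvgD _ _ _ (nbhs x)); apply: coord_continuous. Qed.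

Lemma edge_gap_continuous (v : 'rV[R]_m) : continuous (edge_gap e v).
Proof.
move=> x; apply: (@cvg_big _ _ _ _ _ add_continuous _ (nbhs x)) => p _.
have cB : {for x, continuous (fun y : 'rV[R]_m => edge_sum y p - edge_sum v p)}.
  by apply: continuousB; [exact: edge_sum_continuous|exact: cst_continuous].
exact: (continuousM cB cB).
Qed.

Variables (b d : nat -> 'I_m -> R) (K : R).
Hypothesis m_gt0 : (0 < m)%N.
Let N := num_edges e.
Hypothesis b_gt0 : forall n i, 0 < b n i.
Hypothesis bS : forall n i, b n.+1 i = b n i + d n i.
Hypothesis dK : forall n i, 0 <= d n i <= K.
Hypothesis sum_d : forall n, \sum_i d n i = (num_edges e)%:R.
Hypothesis noise_is_cvg : forall i, cvgn (series (fun k =>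
  d k i / b k i - \sum_(j | e i j) (b k i + b k j)^-1)).

Let S n := \sum_i b n i.
Let x n : 'rV[R]_m := \row_i (b n i / S n).

Let S_gt0 n : 0 < S n.
Proof.
rewrite /S (bigD1 (Ordinal m_gt0)) //=.
by rewrite ltr_wpDr// sumr_ge0// => i _; apply: ltW.
Qed.

Let SS n : S n.+1 = S n + N%:R.
Proof. by rewrite -(sum_d n) -big_split /=; apply: eq_bigr => i _. Qed.

Let x_gt0 n i : 0 < x n ord0 i.
Proof. by rewrite mxE divr_gt0. Qed.

Let x_simplex n : simplex (x n).
Proof.
split=> [i|]; first exact: ltW.
under eq_bigr do rewrite mxE.
by rewrite -mulr_suml divff// gt_eqF//; apply: S_gt0.
Qed.

(** This is [<grad L(x), v> / S], written with the numbers of balls. *)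
Let drift (v : 'rV[R]_m) k :=
  \sum_i v ord0 i * \sum_(j | e i j) (b k i + b k j)^-1 - N%:R / S k.

Let drift_ge v k : equilibria e v -> edge_gap e v (x k) / S k <= drift v k.
Proof.
move=> Jv; have xk i j : e i j -> 0 < x k ord0 i + x k ord0 j.
  by move=> _; rewrite addr_gt0.
have := equilibria_ratio_ge simple_e Jv (x_simplex k) xk.
rewrite ler_pdivrMr ?S_gt0// => h.
rewrite /edge_gap -lerBrDl in h *.
apply: le_trans h _; rewrite edge_ratioE// /drift mulrBl divfK ?(gt_eqF (S_gt0 k))//.
rewrite lerD2r mulr_suml ler_sum// => i _.
rewrite -mulrA ler_wpM2l//; first by have [[]] := Jv.
rewrite mulr_suml ler_sum// => j _; rewrite !mxE -mulrDl invf_div.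
by rewrite mulrC.
Qed.

Let loglik (v : 'rV[R]_m) n := \sum_i v ord0 i * ln (x n ord0 i).

(** The logarithms of the proportions are turned into sums of relative gains, and
    these into the drift by the convergence of the noise. *)
Let loglik_drift v : simplex v ->
  cvgn (fun n => loglik v n - series (drift v) n).
Proof.
move=> [v0 v1].
pose f i n := v ord0 i * (ln (b n i) - series (fun k => d k i / b k i) n).
pose g i n := v ord0 i * series (fun k =>
  d k i / b k i - \sum_(j | e i j) (b k i + b k j)^-1) n.
pose h n := ln (S n) - series (fun k => N%:R / S k) n.
have -> : (fun n => loglik v n - series (drift v) n) =
    (fun n => \sum_i f i n + \sum_i g i n - h n).
  apply/funext => n; rewrite -big_split /=.
  have -> : loglik v n = \sum_i v ord0 i * ln (b n i) - ln (S n).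
    rewrite -[X in _ - X]mul1r -v1 mulr_suml -sumrB; apply: eq_bigr => i _.
    by rewrite -mulrBr mxE ln_div ?posrE ?b_gt0 ?S_gt0.
  have -> : series (drift v) n = \sum_i v ord0 i *
      series (fun k => \sum_(j | e i j) (b k i + b k j)^-1) n -
      series (fun k => N%:R / S k) n.
    rewrite !seriesEnat /= sumrB; congr (_ - _); rewrite exchange_big /=.
    by apply: eq_bigr => i _; rewrite seriesEnat /= mulr_sumr.
  have -> : \sum_i (f i n + g i n) = \sum_i v ord0 i * ln (b n i) -
      \sum_i v ord0 i * series (fun k => \sum_(j | e i j) (b k i + b k j)^-1) n.
    rewrite -sumrB; apply: eq_bigr => i _.
    by rewrite /f /g !seriesEnat /= sumrB; ring.
  by rewrite /h; ring.
apply: is_cvgB; last first.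
  apply: (@cvg_ln_sub_series _ S (fun=> N%:R) N%:R) => //.
  by move=> n; rewrite ler0n lexx.
apply: is_cvgD; apply: cvgn_sum => i _.
  by apply: is_cvgZr; apply: (cvg_ln_sub_series (K := K)) => n.
exact: is_cvgZr.
Qed.

Let loglik_le0 v n : simplex v -> loglik v n <= 0.
Proof.
move=> [v0 v1]; apply: sumr_le0 => i _; rewrite mulr_ge0_le0// ln_le0//.
have [xn0 <-] := x_simplex n.
by rewrite (bigD1 i) //= lerDl sumr_ge0.
Qed.

Let drift_ge0 v k : equilibria e v -> 0 <= drift v k.
Proof.
move=> Jv; apply: le_trans (drift_ge k Jv).
by rewrite divr_ge0 ?edge_gap_ge0// ltW.
Qed.

Let drift_cvg v : equilibria e v -> cvgn (series (drift v)).
Proof.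
move=> Jv; have [Sv _ _] := Jv; have cl := loglik_drift Sv.
apply: nondecreasing_is_cvgn.
  by apply: nondecreasing_series => k _ _; apply: drift_ge0.
have /cvg_seq_bounded/bounded_fun_has_lbound[M HM] := cl.
exists (- M) => _ [n _ <-]; have := HM _ (imageT _ n).
by have := loglik_le0 n Sv; rewrite /=; lra.
Qed.

Let loglik_cvg v : equilibria e v -> cvgn (loglik v).
Proof.
move=> Jv; have [Sv _ _] := Jv.
have -> : loglik v =
    (fun n => (loglik v n - series (drift v) n) + series (drift v) n).
  by apply/funext => n; rewrite subrK.
apply: is_cvgD; [exact: loglik_drift|exact: drift_cvg].
Qed.

Let S_le n : S n <= (S 0%N + N%:R) * n.+1%:R.
Proof.
have S0 := S_gt0 0.
elim: n => [|n IH]; first by rewrite mulr1 lerDl.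
rewrite SS [n.+2%:R]mulrSr mulrDr mulr1; lra.
Qed.

(** Otherwise the drift would dominate a multiple of the harmonic series. *)
Let small_gap v j : equilibria e v ->
  exists2 n, (j <= n)%N & edge_gap e v (x n) < j.+1%:R^-1.
Proof.
move=> Jv; apply: contrapT => /forall2NP nh.
have h k : (j <= k)%N -> j.+1%:R^-1 <= edge_gap e v (x k).
  by move=> jk; have [|/negP] := nh k; rewrite ?jk// -leNgt.
apply: (@dvg_harmonic R).
have S0 := S_gt0 0.
have /cvg_seq_bounded/bounded_fun_has_ubound[M HM] := drift_cvg Jv.
pose C := (S 0%N + N%:R) * j.+1%:R.
have C0 : 0 <= C by rewrite mulr_ge0// addr_ge0// ltW.
apply: nondecreasing_is_cvgn.
  by apply: nondecreasing_series => k _ _; apply: harmonic_ge0.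
exists (j%:R + C * M) => _ [n _ <-].
apply: (@le_trans _ _ (\sum_(0 <= k < n) ((k < j)%N%:R + C * drift v k))).
  apply: ler_sum => k _; rewrite /harmonic /=; have [kj|jk] := ltnP k j.
    rewrite -[leLHS]addr0 lerD//; last by rewrite mulr_ge0 ?drift_ge0.
    by rewrite invf_le1// ler1n.
  rewrite add0r; apply: le_trans (ler_wpM2l C0 (drift_ge k Jv)).
  have gap1 : 1 <= j.+1%:R * edge_gap e v (x k).
    by have := h k jk; rewrite -(ler_pM2l (ltr0Sn R j)) divff.
  rewrite mulrA ler_pdivlMr ?S_gt0// mulrC ler_pdivrMr ?ltr0Sn//.
  apply: le_trans (S_le k) _; rewrite ler_wpM2r// /C -mulrA ler_peMr//.
  by rewrite addr_ge0// ltW.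
rewrite big_split /= lerD//; last first.
  by rewrite -mulr_sumr ler_wpM2l//; apply: (HM (series (drift v) n)); exists n.
rewrite -natr_sum ler_nat; elim: n => [|n IH]; first by rewrite big_geq.
have : (\sum_(0 <= i < n) (i < j) <= minn n j)%N.
  elim: n {IH} => [|n IH]; first by rewrite big_geq.
  rewrite big_nat_recr //=; move: IH; lia.
rewrite big_nat_recr //=; lia.
Qed.

Theorem proportions_cvg : exists2 z, equilibria e z & x n @[n --> \oo] --> z.
Proof.
have [v Jv] := equilibria_nonempty R simple_e m_gt0.
have /choice[f Hf] : forall j, exists n, (j <= n)%N /\ edge_gap e v (x n) < j.+1%:R^-1.
  by move=> j; have [n] := small_gap j Jv; exists n.
have f_oo : f j @[j --> \oo] --> \oo.
  move=> A [n0 _ hA]; exists n0 => // j /= n0j; apply: hA => /=.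
  by apply: leq_trans n0j _; have [] := Hf j.
have [|z [Sz clz]] := @simplex_compact R m ((x \o f) @ \oo) _.
  by exists 0%N => // n _; apply: x_simplex.
have Jz : equilibria e z.
  apply: (equilibria_transfer Jv Sz); apply: (edge_gap_eq0 simple_e).
  apply: (cluster_continuous_lim clz (@edge_gap_continuous v z)).
  apply: (@squeeze_cvgr _ _ _ _ (fun=> 0) (@harmonic R)).
  - by near=> j; rewrite edge_gap_ge0 /=; have [_ /ltW] := Hf j.
  - exact: cvg_cst.
  - exact: cvg_harmonic.
exists z => //; apply: simplex_kl_cvg => //.
(* The whole sequence of log-likelihoods converges, so its limit is its value at
   the cluster point. *)
have /cvg_ex[/= l ll] := loglik_cvg Jz.
suff -> : \sum_i z ord0 i * ln (z ord0 i) = l by [].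
pose g (y : 'rV[R]_m) := \sum_i z ord0 i * ln (y ord0 i).
apply: (cluster_continuous_lim (g := g) clz); last first.
  exact: (cvg_comp _ _ f_oo ll).
apply: (@cvg_big _ _ _ _ _ add_continuous _ (nbhs z)) => i _.
(* [ln] is discontinuous at 0, but there the weight vanishes. *)
have [z0|z0] := eqVneq (z ord0 i) 0.
  by rewrite z0; under eq_fun do rewrite mul0r; rewrite mul0r; apply: cvg_cst.
apply: cvgM; first exact: cvg_cst.
have [[/(_ i) zi _] _ _] := Jz.
apply: (@continuous_comp _ _ _ (fun y : 'rV[R]_m => y ord0 i) (@ln R)).
  exact: coord_continuous.
by apply: continuous_ln; rewrite lt0r z0.
Unshelve. all: by end_near. Qed.

End DeterministicConvergence.

(** * Almost sure convergence of square-summable martingale differences *)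

Section MartingaleDifferences.
Variables (R : realType) (d : measure_display) (T : measurableType d).
Variable P : probability T R.
Implicit Types X Y : T -> R.

(** Boundedness settles all questions of integrability; it holds here because the
    urn has finitely many possible states at each step. *)
Definition bounded_rv X : Prop :=
  measurable_fun setT X /\ exists C, forall w, `|X w| <= C.

Definition mean X : R := \int[P]_w X w.

Lemma bounded_rv_integrable X : bounded_rv X -> P.-integrable setT (EFin \o X).
Proof.
move=> [mX [C XC]]; apply: measurable_bounded_integrable => //.
  by rewrite -ge0_fin_numE // fin_num_measure.
exists C; split; first exact: num_real.
by move=> y Cy w _; apply: le_trans (XC w) (ltW Cy).
Qed.

Lemma bounded_rv_cst (c : R) : bounded_rv (fun=> c).
Proof. by split; [exact: measurable_cst|exists `|c|]. Qed.

Lemma bounded_rvD X Y : bounded_rv X -> bounded_rv Y ->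
  bounded_rv (fun w => X w + Y w).
Proof.
move=> [mX [C XC]] [mY [D YD]]; split; first exact: measurable_funD.
by exists (C + D) => w; apply: le_trans (ler_normD _ _) _; rewrite lerD.
Qed.

Lemma bounded_rvM X Y : bounded_rv X -> bounded_rv Y ->
  bounded_rv (fun w => X w * Y w).
Proof.
move=> [mX [C XC]] [mY [D YD]]; split; first exact: measurable_funM.
by exists (C * D) => w; rewrite normrM ler_pM.
Qed.

Lemma bounded_rvZ (c : R) X : bounded_rv X -> bounded_rv (fun w => c * X w).
Proof. by move=> bX; apply: bounded_rvM bX; apply: bounded_rv_cst. Qed.

Lemma bounded_rv_sum (I : Type) (s : seq I) (Q : pred I) (X : I -> T -> R) :
  (forall i, Q i -> bounded_rv (X i)) ->
  bounded_rv (fun w => \sum_(i <- s | Q i) X i w).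
Proof.
move=> bX; elim: s => [|i s IH].
  under eq_fun do rewrite big_nil.
  exact: bounded_rv_cst.
have [Qi|/negbTE nQi] := boolP (Q i).
  under eq_fun do rewrite big_cons Qi.
  by apply: bounded_rvD => //; apply: bX.
by under eq_fun do rewrite big_cons nQi.
Qed.

Lemma bounded_rv_indic (A : set T) : measurable A -> bounded_rv (\1_A : T -> R).
Proof.
move=> mA; split; first exact: measurable_indic.
by exists 1 => w; rewrite indicE; case: (w \in A); rewrite ?normr1 ?normr0.
Qed.

Lemma bounded_rv_bool (b : T -> bool) : measurable [set w | b w] ->
  bounded_rv (fun w => (b w)%:R).
Proof.
move=> mb; have -> : (fun w => (b w)%:R) = (\1_[set w | b w] : T -> R).
  apply/funext => w; rewrite indicE; congr (nat_of_bool _)%:R.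
  by apply/idP/idP => [h|/set_mem //]; apply: mem_set.
exact: bounded_rv_indic.
Qed.

Lemma measurable_norm_le X (c : R) : bounded_rv X ->
  measurable [set w | `|X w| <= c].
Proof.
move=> [mX _]; rewrite -[X in measurable X]setTI.
by apply: measurable_fun_le => //; apply: measurableT_comp.
Qed.

Lemma meanD X Y : bounded_rv X -> bounded_rv Y ->
  mean (fun w => X w + Y w) = mean X + mean Y.
Proof. by move=> bX bY; apply: RintegralD => //; apply: bounded_rv_integrable. Qed.

Lemma meanZ (c : R) X : bounded_rv X -> mean (fun w => c * X w) = c * mean X.
Proof. by move=> bX; apply: RintegralZl => //; apply: bounded_rv_integrable. Qed.

Lemma mean_cst (c : R) : mean (fun=> c) = c.
Proof.
rewrite /mean Rintegral_cst// -[RHS]mulr1; congr (_ * _).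
by have /(congr1 fine) := probability_setT P.
Qed.

Lemma mean_sum (I : Type) (s : seq I) (Q : pred I) (X : I -> T -> R) :
  (forall i, Q i -> bounded_rv (X i)) ->
  mean (fun w => \sum_(i <- s | Q i) X i w) = \sum_(i <- s | Q i) mean (X i).
Proof.
move=> bX; elim: s => [|i s IH].
  under eq_fun do rewrite big_nil.
  by rewrite big_nil mean_cst.
rewrite big_cons; have [Qi|/negbTE nQi] := boolP (Q i).
  under eq_fun do rewrite big_cons Qi.
  by rewrite meanD ?IH//; [exact: bX|exact: bounded_rv_sum].
by under eq_fun do rewrite big_cons nQi.
Qed.

Lemma le_mean X Y : bounded_rv X -> bounded_rv Y ->
  (forall w, X w <= Y w) -> mean X <= mean Y.
Proof. by move=> bX bY XY; apply: le_Rintegral => //; apply: bounded_rv_integrable. Qed.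

Lemma mean_ge0 X : (forall w, 0 <= X w) -> 0 <= mean X.
Proof. by move=> X0; apply: Rintegral_ge0. Qed.

Lemma mean_indic (A : set T) : measurable A -> mean \1_A = fine (P A).
Proof. by move=> mA; rewrite /mean /Rintegral integral_indic// setIT. Qed.

(** Measurability with respect to the past is replaced by the pointwise condition
    of being a function of the past values; for bounded measurable [Y] it is the
    weaker requirement on [Y], hence the stronger one on [xi]. *)
Definition determined_by (xi : nat -> T -> R) (n : nat) Y : Prop :=
  forall w w', (forall l, (l < n)%N -> xi l w = xi l w') -> Y w = Y w'.

Definition martingale_difference (xi : nat -> T -> R) : Prop :=
  (forall n, bounded_rv (xi n)) /\
  forall n Y, bounded_rv Y -> determined_by xi n Y ->
    mean (fun w => Y w * xi n w) = 0.

Section Convergence.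
Variable xi : nat -> T -> R.
Hypothesis xi_md : martingale_difference xi.

Let psum n k w := \sum_(n <= l < n + k) xi l w.

(** The partial sum from [n] on, frozen at the first time it exceeds [eps] in
    absolute value: testing its current value is enough, since a frozen value
    remains above [eps]. *)
Fixpoint stopped (eps : R) (n k : nat) (w : T) : R :=
  if k is k'.+1 then
    stopped eps n k' w + (`|stopped eps n k' w| <= eps)%R%:R * xi (n + k') w
  else 0.

Let stopped_bounded eps n k : bounded_rv (stopped eps n k).
Proof.
elim: k => [|k IH] /=; first exact: bounded_rv_cst.
apply: bounded_rvD => //; apply: bounded_rvM; last exact: xi_md.1.
by apply: bounded_rv_bool; apply: measurable_norm_le.
Qed.

Let stopped_determined eps n k : determined_by xi (n + k) (stopped eps n k).
Proof.
elim: k => [//|k IH] w w' ww' /=.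
rewrite (IH w w') ?ww' ?addnS// => l lk; apply: ww'.
by rewrite addnS ltnW.
Qed.

Let stopped_psum eps n k w : `|stopped eps n k w| <= eps ->
  stopped eps n k w = psum n k w /\
  forall j, (j <= k)%N -> `|psum n j w| <= eps.
Proof.
elim: k => [|k IH] /=.
  rewrite /psum addn0 big_geq// => h; split=> // j; rewrite leqn0 => /eqP ->.
  by rewrite addn0 big_geq.
case: (boolP (`|stopped eps n k w| <= eps)) => [h|h]; last first.
  by rewrite mul0r addr0 (negbTE h).
have [-> h2] := IH h; rewrite mul1r => h3.
have E : psum n k.+1 w = psum n k w + xi (n + k) w.
  by rewrite /psum addnS big_nat_recr ?leq_addr.
split=> // j; rewrite leq_eqVlt => /orP[/eqP ->|]; first by rewrite E.
exact: h2.
Qed.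

Let stopped_moment eps n k :
  mean (fun w => stopped eps n k w ^+ 2) <=
  \sum_(n <= l < n + k) mean (fun w => xi l w ^+ 2).
Proof.
elim: k => [|k IH] /=.
  by rewrite addn0 big_geq// expr0n /= mean_cst.
rewrite addnS big_nat_recr ?leq_addr//=.
pose Z := stopped eps n k; pose I w : R := (`|Z w| <= eps)%R%:R.
have bZ : bounded_rv Z by exact: stopped_bounded.
have bI : bounded_rv I by apply: bounded_rv_bool; apply: measurable_norm_le.
have bx : bounded_rv (xi (n + k)) by exact: xi_md.1.
have I01 w : 0 <= I w <= 1 by rewrite ler0n lern1 leq_b1.
have bZ2 : bounded_rv (fun w => Z w ^+ 2).
  by under eq_fun do rewrite expr2; apply: bounded_rvM.
have bx2 : bounded_rv (fun w => xi (n + k) w ^+ 2).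
  by under eq_fun do rewrite expr2; apply: bounded_rvM.
have bIx : bounded_rv (fun w => Z w * I w * xi (n + k) w).
  by apply: bounded_rvM => //; apply: bounded_rvM.
have b2 : bounded_rv (fun w => 2 * (Z w * I w * xi (n + k) w)).
  exact: bounded_rvZ.
have orth : mean (fun w => Z w * I w * xi (n + k) w) = 0.
  apply: xi_md.2; first exact: bounded_rvM.
  move=> w w' ww'; rewrite /I.
  by rewrite /Z (stopped_determined eps ww').
apply: (@le_trans _ _ (mean (fun w => (Z w ^+ 2 +
    2 * (Z w * I w * xi (n + k) w)) + xi (n + k) w ^+ 2))).
  apply: le_mean.
  - have b := stopped_bounded eps n k.+1.
    by under eq_fun do rewrite expr2; apply: bounded_rvM.
  - by apply: bounded_rvD => //; apply: bounded_rvD.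
  - move=> w; rewrite -/Z -/(I w); have /andP[I0 I1] := I01 w.
    have : I w * I w * xi (n + k) w ^+ 2 <= xi (n + k) w ^+ 2.
      by rewrite ler_piMl ?sqr_ge0// mulr_ile1.
    lra.
rewrite meanD//; last exact: bounded_rvD.
by rewrite meanD// meanZ// orth mulr0 addr0 lerD2r.
Qed.

Let exceed eps n k := [set w | eps < `|stopped eps n k w|].

Let exceed_measurable eps n k : measurable (exceed eps n k).
Proof.
have -> : exceed eps n k = ~` [set w | `|stopped eps n k w| <= eps].
  by apply/seteqP; split=> w; rewrite /exceed /= ltNge => /negP.
by apply: measurableC; apply: measurable_norm_le.
Qed.

(** Kolmogorov's maximal inequality: by [stopped_psum], the final value of the
    stopped sum tells whether the level was ever exceeded. *)
Let exceed_prob eps n k : 0 < eps ->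
  fine (P (exceed eps n k)) <=
  (\sum_(n <= l < n + k) mean (fun w => xi l w ^+ 2)) / eps ^+ 2.
Proof.
move=> e0; rewrite ler_pdivlMr ?exprn_gt0// mulrC.
apply: le_trans (stopped_moment eps n k).
have bI : bounded_rv (\1_(exceed eps n k) : T -> R).
  by apply: bounded_rv_indic; apply: exceed_measurable.
rewrite -mean_indic; last exact: exceed_measurable.
rewrite -meanZ//; apply: le_mean; first exact: bounded_rvZ.
  have b := stopped_bounded eps n k.
  by under eq_fun do rewrite expr2; apply: bounded_rvM.
move=> w; rewrite indicE; case: (boolP (w \in _)) => [/set_mem /= h|_].
  rewrite mulr1 -[leRHS]real_normK ?num_real//.
  by apply: lerXn2r; rewrite ?nnegrE//; apply: ltW.
by rewrite mulr0 sqr_ge0.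
Qed.

Let exceed_nd eps n : nondecreasing_seq (exceed eps n).
Proof.
apply/nondecreasing_seqP => k; apply/subsetPset => w /=.
by rewrite /exceed /= ltNge => /negbTE h; rewrite h mul0r addr0 ltNge h.
Qed.

Variable C : R.
Hypothesis moments_le : forall n, \sum_(0 <= l < n) mean (fun w => xi l w ^+ 2) <= C.

Let moments_cvg : cvgn (series (fun l => mean (fun w => xi l w ^+ 2))).
Proof.
apply: nondecreasing_is_cvgn.
  by apply: nondecreasing_series => l _ _; apply: mean_ge0 => w; exact: sqr_ge0.
by exists C => _ [n _ <-]; exact: moments_le.
Qed.

Let tail n := limn (series (fun l => mean (fun w => xi l w ^+ 2))) -
  \sum_(0 <= l < n) mean (fun w => xi l w ^+ 2).

Let tail_cvg0 : tail n @[n --> \oo] --> 0.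
Proof.
rewrite -(subrr (limn (series (fun l => mean (fun w => xi l w ^+ 2))))).
apply: cvgB; first exact: cvg_cst.
by have := moments_cvg; rewrite seriesEnat.
Qed.

Let psum_le_tail n k : \sum_(n <= l < n + k) mean (fun w => xi l w ^+ 2) <= tail n.
Proof.
rewrite /tail lerBrDl -big_cat_nat ?leq_addr//=.
have := nondecreasing_cvgn_le _ moments_cvg (n + k); rewrite seriesEnat; apply.
rewrite -seriesEnat.
by apply: nondecreasing_series => l _ _; apply: mean_ge0 => w; exact: sqr_ge0.
Qed.

Let escape eps n := \bigcup_k exceed eps n k.

Let escape_prob eps n : 0 < eps -> (P (escape eps n) <= (tail n / eps ^+ 2)%:E)%E.
Proof.
move=> e0; have mU : measurable (escape eps n) by exact: bigcupT_measurable.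
have h := nondecreasing_cvg_mu (mu := P) (exceed_measurable eps n) mU (exceed_nd eps n).
rewrite -(cvg_lim _ h)//; apply: lime_le.
  by apply/cvg_ex; eexists; exact: h.
near=> k; rewrite /= -[leLHS]fineK ?fin_num_measure// lee_fin.
apply: le_trans (exceed_prob _ _ e0) _.
by rewrite ler_wpM2r ?psum_le_tail// invr_ge0 sqr_ge0.
Unshelve. all: by end_near. Qed.

Let escape_negligible eps : 0 < eps -> P.-negligible (\bigcap_n escape eps n).
Proof.
move=> e0; have mE n : measurable (escape eps n) by exact: bigcupT_measurable.
apply/negligibleP; first exact: bigcapT_measurable.
apply/eqP; rewrite -measure_le0; apply/lee_addgt0Pr => del del0; rewrite add0e.
have : 0 < del * eps ^+ 2 by rewrite mulr_gt0// exprn_gt0.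
have /cvgr0Pnorm_lt := tail_cvg0 => /[apply] -[n _ /(_ n (leqnn _)) /= hn].
apply: (@le_trans _ _ (P (escape eps n))).
  by apply: le_measure; rewrite ?inE//; [exact: bigcapT_measurable|exact: bigcap_inf].
apply: le_trans (escape_prob _ e0) _; rewrite lee_fin ler_pdivrMr ?exprn_gt0//.
exact: le_trans (ler_norm _) (ltW hn).
Qed.

(** The maximal inequality bounds the probability that the partial sums ever move
    by more than [eps] after [n] by the tail of the second moments over [eps^2];
    so almost surely they form a Cauchy sequence. *)
Theorem martingale_difference_cvg :
  {ae P, forall w, cvgn (series (fun n => xi n w))}.
Proof.
have : {ae P, forall w, forall j, ~ (\bigcap_n escape j.+1%:R^-1 n) w}.
  apply: ae_foralln => j; have := @escape_negligible j.+1%:R^-1.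
  rewrite invr_gt0 ltr0Sn => /(_ isT); apply: negligibleS => w /=.
  by move/contrapT.
apply: filterS => w hw; apply/cauchy_cvgP/cauchyP => eps eps0.
have [j _ /(_ j (leqnn _)) hj] : \forall j \near \oo, j.+1%:R^-1 < eps.
  have /cvgr0Pnorm_lt/(_ _ eps0) := @cvg_harmonic R.
  by apply: filterS => j; apply: le_lt_trans; exact: ler_norm.
have := hw j; rewrite /= in hj * => /existsNP[n /not_implyP[_ hn]].
exists (series (fun n => xi n w) n); exists n => // k /= nk.
rewrite /ball /=; apply: le_lt_trans hj.
have : ~ exceed j.+1%:R^-1 n (k - n) w by move=> h; apply: hn; exists (k - n)%N.
rewrite /exceed /= => /negP; rewrite -leNgt => /stopped_psum[_ /(_ _ (leqnn _))].
rewrite /psum subnKC// distrC; congr (`|_| <= _).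
by rewrite -sub_series_geq // /series /= .
Qed.

End Convergence.
End MartingaleDifferences.

(** * The urn *)

Section Urn.
Variables (R : realType) (m : nat) (e : rel 'I_m) (B0 : 'I_m -> nat).
Variables (d : measure_display) (T : measurableType d) (P : probability T R).
Variables (B : nat -> 'I_m -> T -> nat) (won : nat -> 'I_m -> 'I_m -> T -> bool).
Hypothesis simple_e : simple_graph e.
Hypothesis B0_gt0 : forall i, (1 <= B0 i)%N.
Hypothesis urn : polya_urn e B0 P B won.
Implicit Types Y : T -> R.

Definition gain n i w : nat := \sum_(j < m | e i j) won n i j w.

Lemma urnS n i w : B n.+1 i w = (B n i w + gain n i w)%N.
Proof. exact: urn_step urn n i w. Qed.

Lemma urn_gt0 n i w : (0 < B n i w)%N.
Proof.
elim: n => [|n IH]; first by rewrite (urn_init urn).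
by rewrite urnS addn_gt0 IH.
Qed.

Lemma gain_le n i w : (gain n i w <= m)%N.
Proof.
rewrite /gain big_mkcond /= -[leqRHS]card_ord -sum1_card; apply: leq_sum => j _.
by case: ifP => // _; apply: leq_b1.
Qed.

Lemma sum_gain n w : (\sum_(i < m) gain n i w = num_edges e)%N.
Proof.
rewrite /gain (sum_over_edges simple_e (fun i j => nat_of_bool (won n i j w))).
rewrite -[RHS]sum1_card; apply: eq_bigr => p; rewrite inE => /andP[_ ep].
by rewrite (urn_one_ball urn n w ep); case: (won _ _ _ _).
Qed.

Lemma urn_total n w : (\sum_i B n i w = \sum_i B0 i + n * num_edges e)%N.
Proof.
elim: n => [|n IH].
  by rewrite mul0n addn0; apply: eq_bigr => i _; apply: urn_init urn i w.
under eq_bigr do rewrite urnS.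
by rewrite big_split /= IH sum_gain mulSn -addnA [(_ * _ + _)%N]addnC.
Qed.

Let balls n i w : R := (B n i w)%:R.

Let balls_gt0 n i w : 0 < balls n i w.
Proof. by rewrite ltr0n urn_gt0. Qed.

Let won_bounded n i j : e i j -> bounded_rv (fun w => (won n i j w)%:R : R).
Proof.
move=> eij; have mW := urn_measurable urn n eij.
exact: bounded_rv_bool.
Qed.

Let balls_bounded n i : bounded_rv (balls n i).
Proof.
elim: n i => [|n IH] i.
  have -> : balls 0 i = fun=> (B0 i)%:R.
    by apply/funext => w; rewrite /balls (urn_init urn).
  exact: bounded_rv_cst.
have -> : balls n.+1 i =
    (fun w => balls n i w + \sum_(j < m | e i j) (won n i j w)%:R).
  by apply/funext => w; rewrite /balls urnS natrD /gain natr_sum.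
by apply: bounded_rvD => //; apply: bounded_rv_sum => j; apply: won_bounded.
Qed.

Lemma history_measurable n h : measurable (history B n h).
Proof.
have -> : history B n h =
    \bigcap_(k in [set k | (k <= n)%N]) \bigcap_(i in [set: 'I_m])
      [set w | B k i w = h k i].
  by apply/seteqP; split=> w hw; [move=> k kn i _; apply: hw|
    move=> k i kn; apply: (hw k kn i)].
apply: bigcap_measurable => [|k _]; first by exists 0%N.
apply: fin_bigcap_measurable => // i _.
have -> : [set w | B k i w = h k i] = setT `&` balls k i @^-1` [set (h k i)%:R].
  rewrite setTI; apply/seteqP; split=> w /=; first by rewrite /balls => ->.
  by rewrite /balls => /eqP; rewrite eqr_nat => /eqP.
by apply: (balls_bounded k i).1.
Qed.

Definition history_determined n Y : Prop :=
  forall w w', (forall k i, (k <= n)%N -> B k i w = B k i w') -> Y w = Y w'.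

Let ball_bound n := (\sum_i B0 i + n * num_edges e)%N.

Let urn_bound n k i w : (k <= n)%N -> (B k i w < (ball_bound n).+1)%N.
Proof.
move=> kn; rewrite ltnS; apply: (@leq_trans (\sum_i B k i w)%N).
  by rewrite (bigD1 i) //= leq_addr.
by rewrite urn_total leq_add2l leq_mul2r kn orbT.
Qed.

(** The number of balls being bounded, the histories up to step [n] form a finite
    type; every function of the history is thus a finite linear combination of
    indicators of atoms, on which the conditional law is given. *)
Let code n := {ffun 'I_n.+1 * 'I_m -> 'I_(ball_bound n).+1}.

Let decode n (c : code n) (k : nat) (i : 'I_m) : nat := c (inord k, i).

Let encode n w : code n := [ffun p => inord (B (p.1 : 'I_n.+1) p.2 w)].

Let atom n (c : code n) := history B n (decode c).

Let encodeP n w (c : code n) : atom c w <-> encode n w = c.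
Proof.
split=> [h|<- k i kn].
  apply/ffunP => -[k i]; rewrite ffunE /= h -1?ltnS// /decode inord_val.
  by rewrite inord_val.
rewrite /decode ffunE /= inordK; first by rewrite inordK ?urn_bound.
by rewrite urn_bound// inordK.
Qed.

Let atom_value n Y (c : code n) : R :=
  if pselect (exists w, atom c w) is left ex then Y (sval (cid ex)) else 0.

Let atom_decomposition n Y w : history_determined n Y ->
  Y w = \sum_(c : code n) atom_value Y c * \1_(atom c) w.
Proof.
move=> dY; have aw : atom (encode n w) w by apply/encodeP.
rewrite (bigD1 (encode n w)) //= [X in _ + X]big1 ?addr0 => [|c cw]; last first.
  rewrite indicE memNset ?mulr0// => /encodeP wc.
  by rewrite wc eqxx in cw.
rewrite indicE mem_set// mulr1 /atom_value; case: pselect => [ex|]; last first.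
  by move=> h; exfalso; apply: h; exists w.
by case: cid => w' aw' /=; apply: dY => k i kn; rewrite (aw k i kn) (aw' k i kn).
Qed.

Lemma history_determined_bounded n Y : history_determined n Y -> bounded_rv Y.
Proof.
move=> dY; have -> : Y = fun w => \sum_(c : code n) atom_value Y c * \1_(atom c) w.
  by apply/funext => w; apply: atom_decomposition.
apply: bounded_rv_sum => c _; apply: bounded_rvZ; apply: bounded_rv_indic.
exact: history_measurable.
Qed.

Lemma urn_orthogonality n i j Y : e i j -> history_determined n Y ->
  mean P (fun w => Y w *
    ((won n i j w)%:R - balls n i w / (balls n i w + balls n j w))) = 0.
Proof.
move=> eij dY; pose W := [set w | won n i j w].
have mW : measurable W := urn_measurable urn n eij.
have mA (c : code n) : measurable (atom c) by apply: history_measurable.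
pose p (c : code n) : R := (decode c n i)%:R / ((decode c n i)%:R + (decode c n j)%:R).
have -> : (fun w => Y w *
    ((won n i j w)%:R - balls n i w / (balls n i w + balls n j w))) =
    (fun w => \sum_(c : code n) (atom_value Y c * \1_(W `&` atom c) w +
                     (- (atom_value Y c * p c)) * \1_(atom c) w)).
  apply/funext => w; rewrite (atom_decomposition w dY) mulr_suml.
  apply: eq_bigr => c _; rewrite indicI /= [\1_(atom c) w]indicE.
  case: (boolP (w \in _)) => [/set_mem aw|_]; last by rewrite !(mulr0, mul0r, addr0).
  rewrite !mulr1 /balls !(aw _ _ (leqnn n)) -/(p c) indicE mulrBr.
  congr (_ * _%:R - _); congr nat_of_bool.
  by apply/idP/idP => [h|/set_mem //]; apply: mem_set.
have mWA (c : code n) : measurable (W `&` atom c) by apply: measurableI.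
have b1 (c : code n) : bounded_rv (\1_(W `&` atom c) : T -> R) by apply: bounded_rv_indic.
have b2 (c : code n) : bounded_rv (\1_(atom c) : T -> R) by apply: bounded_rv_indic.
rewrite mean_sum => [|c _]; last by apply: bounded_rvD; apply: bounded_rvZ.
apply: big1 => c _; rewrite meanD; [|exact: bounded_rvZ|exact: bounded_rvZ].
rewrite !meanZ// !mean_indic//.
have [PA0|PA0] := eqVneq (P (atom c)) 0%E.
  have -> : P (W `&` atom c) = 0%E.
    by apply/eqP; rewrite -measure_le0 -PA0 le_measure ?inE//; apply: subIsetr.
  by rewrite PA0 /= !mulr0 addr0.
have := urn_law urn eij PA0; rewrite /cond_prob -/(atom c) -/W -/(p c).
have fP0 : fine (P (atom c)) != 0.
  by apply: contra_neq PA0 => h; rewrite -[LHS]fineK ?h// fin_num_measure.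
by move=> /(canRL (divfK fP0)) ->; ring.
Qed.

(** The relative gain of bin [i] at step [n.+1] minus its conditional mean. *)
Definition noise i n w : R :=
  (gain n i w)%:R / balls n i w -
  \sum_(j | e i j) (balls n i w + balls n j w)^-1.

Lemma noiseE i n w : noise i n w = \sum_(j | e i j) (balls n i w)^-1 *
  ((won n i j w)%:R - balls n i w / (balls n i w + balls n j w)).
Proof.
rewrite /noise /gain natr_sum mulr_suml -sumrB; apply: eq_bigr => j _.
have := balls_gt0 n i w; have := balls_gt0 n j w.
move: (balls n i w) (balls n j w) => a b a0 b0.
by field; rewrite !gt_eqF// addr_gt0.
Qed.

Let noise_determined i n : history_determined n.+1 (noise i n).
Proof.
move=> w w' ww'; have h j : B n j w = B n j w' by apply: ww'.
have -> : noise i n w = ((B n.+1 i w)%:R - (B n i w)%:R) / (B n i w)%:R -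
    \sum_(j | e i j) ((B n i w)%:R + (B n j w)%:R)^-1.
  by rewrite /noise urnS natrD [_ + _%:R]addrC addrK.
rewrite ww'// h; under eq_bigr do rewrite h.
by rewrite urnS natrD [_ + (gain _ _ _)%:R]addrC addrK.
Qed.

Let orthogonal_noise i n Y : history_determined n Y ->
  mean P (fun w => Y w * noise i n w) = 0.
Proof.
move=> dY; have dYb : history_determined n (fun w => Y w * (balls n i w)^-1).
  by move=> w w' ww'; rewrite (dY w w' ww') /balls ww'.
have -> : (fun w => Y w * noise i n w) = (fun w => \sum_(j | e i j)
    (Y w * (balls n i w)^-1 *
     ((won n i j w)%:R - balls n i w / (balls n i w + balls n j w)))).
  apply/funext => w; rewrite noiseE mulr_sumr; apply: eq_bigr => j _.
  by rewrite mulrA.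
rewrite mean_sum => [|j eij].
  by apply: big1 => j eij; apply: urn_orthogonality.
apply: bounded_rvM; first exact: history_determined_bounded dYb.
apply: bounded_rvD; first exact: won_bounded.
apply: (@history_determined_bounded n) => w w' ww'.
by rewrite /balls !ww'.
Qed.

Lemma noise_martingale_difference i : martingale_difference P (noise i).
Proof.
split=> [n|n Y _ dY]; first exact: history_determined_bounded (@noise_determined i n).
apply: orthogonal_noise => w w' ww'; apply: dY => l ln.
by apply: noise_determined => k j kl; apply: ww'; apply: leq_trans kl ln.
Qed.

Let rate i n w : R := (gain n i w)%:R / balls n i w.

Let rate_bounded i n : bounded_rv (rate i n).
Proof.
apply: (@history_determined_bounded n.+1) => w w' ww'.
have h : gain n i w = gain n i w'.
  by apply: (@addnI (B n i w)); rewrite -urnS ww'// urnS -ww'.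
by rewrite /rate h /balls ww'.
Qed.

(** A conditional variance is at most the conditional second moment. *)
Let noise_moment_le i n :
  mean P (fun w => noise i n w ^+ 2) <= mean P (fun w => rate i n w ^+ 2).
Proof.
pose c w : R := \sum_(j | e i j) (balls n i w + balls n j w)^-1.
have dc : history_determined n c.
  by move=> w w' ww'; rewrite /c; apply: eq_bigr => j _; rewrite /balls !ww'.
have bx := (noise_martingale_difference i).1 n.
have bc := history_determined_bounded dc.
have b1 : bounded_rv (fun w => c w * noise i n w) by apply: bounded_rvM.
have b2 : bounded_rv (fun w => 2 * (c w * noise i n w)) by apply: bounded_rvZ.
have b3 : bounded_rv (fun w => noise i n w ^+ 2).
  by under eq_fun do rewrite expr2; apply: bounded_rvM.
have b4 : bounded_rv (fun w => rate i n w ^+ 2).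
  by under eq_fun do rewrite expr2; apply: bounded_rvM.
have <- : mean P (fun w => noise i n w ^+ 2 + 2 * (c w * noise i n w)) =
    mean P (fun w => noise i n w ^+ 2).
  by rewrite meanD// meanZ// orthogonal_noise// mulr0 addr0.
apply: le_mean => //; first exact: bounded_rvD.
move=> w; have -> : rate i n w = noise i n w + c w by rewrite /noise subrK.
have := sqr_ge0 (c w); move: (noise i n w) (c w) => a b; lra.
Qed.

(** When [b >= 1] grows to [b + g] with [g <= m], the square of [g / b] is at most
    [m (1 + m)] times [1 / b - 1 / (b + g)]. *)
Let rate_sq_telescope i n w :
  \sum_(0 <= k < n) rate i k w ^+ 2 <= m%:R * (1 + m%:R) * (1 - (balls n i w)^-1).
Proof.
elim: n => [|n IH].
  rewrite big_geq//; apply: mulr_ge0; first by rewrite mulr_ge0 ?addr_ge0.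
  by rewrite subr_ge0 invf_le1 ?balls_gt0// ler1n urn_gt0.
rewrite big_nat_recr //=.
suff : rate i n w ^+ 2 <=
    m%:R * (1 + m%:R) * ((balls n i w)^-1 - (balls n.+1 i w)^-1) by lra.
have bE : balls n.+1 i w = balls n i w + (gain n i w)%:R by rewrite /balls urnS natrD.
have b1 : 1 <= balls n i w by rewrite ler1n urn_gt0.
have g0 : 0 <= (gain n i w)%:R :> R by [].
have gm : (gain n i w)%:R <= m%:R :> R by rewrite ler_nat gain_le.
rewrite /rate bE; move: (balls n i w) ((gain n i w)%:R : R) (m%:R : R) b1 g0 gm.
move=> b g K b1 g0 gK; have b0 : 0 < b by lra.
have bg : 0 < b + g by lra.
have -> : K * (1 + K) * (b^-1 - (b + g)^-1) = K * (1 + K) * g / (b * (b + g)).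
  by field; rewrite !gt_eqF.
rewrite ler_pdivlMr ?mulr_gt0//.
have -> : (g / b) ^+ 2 * (b * (b + g)) = (g * g) * (1 + g / b).
  by field; rewrite gt_eqF.
have gb : g / b <= K.
  by apply: le_trans gK; rewrite ler_pdivrMr// ler_peMr.
have -> : K * (1 + K) * g = (K * g) * (1 + K) by ring.
apply: ler_pM; rewrite ?mulr_ge0 ?addr_ge0 ?divr_ge0// ?ler_wpM2r ?lerD2l//.
exact: ltW.
Qed.

Lemma noise_cvg : {ae P, forall w, forall i, cvgn (series (fun n => noise i n w))}.
Proof.
apply: filter_forall => i.
apply: (martingale_difference_cvg (noise_martingale_difference i)
  (C := m%:R * (1 + m%:R))) => n.
apply: (@le_trans _ _ (mean P (fun w => \sum_(0 <= k < n) rate i k w ^+ 2))).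
  rewrite mean_sum => [|k _]; first by apply: ler_sum => k _; apply: noise_moment_le.
  by under eq_fun do rewrite expr2; apply: bounded_rvM.
rewrite -[leRHS](mean_cst P); apply: le_mean.
- apply: bounded_rv_sum => k _.
  by under eq_fun do rewrite expr2; apply: bounded_rvM.
- exact: bounded_rv_cst.
move=> w; apply: le_trans (rate_sq_telescope i n w) _.
rewrite ler_piMr ?mulr_ge0 ?addr_ge0// gerBl invr_ge0.
exact: ltW.
Qed.

Hypothesis m_gt0 : (0 < m)%N.

Theorem urn_proportions_cvg : {ae P, forall w, exists2 z : 'rV[R]_m,
  equilibria e z & proportions R e B0 B w n @[n --> \oo] --> z}.
Proof.
have := noise_cvg; apply: filterS => w hw.
have := @proportions_cvg R m e simple_e (fun n i => balls n i w)
  (fun n i => (gain n i w)%:R) m%:R m_gt0.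
case => //.
- by move=> n i; rewrite /balls urnS natrD.
- by move=> n i; rewrite ler0n ler_nat gain_le.
- by move=> n; rewrite -natr_sum sum_gain.
move=> z Jz xz; exists z => //.
suff -> : proportions R e B0 B w =
  (fun n => \row_i (balls n i w / \sum_i balls n i w)) by [].
apply/funext => n; apply/rowP => i; rewrite !mxE -natr_sum urn_total.
by [].
Qed.

End Urn.

Theorem corollary1p2 (R : realType) (m : nat) (e : rel 'I_m)
    (simple_e : simple_graph e) (connected_e : connected_graph e) :
  exists J : set 'rV[R]_m,
    [/\ closed_interval J,
        forall (B0 : 'I_m -> nat) (d : measure_display) (T : measurableType d)
            (P : probability T R) (B : nat -> 'I_m -> T -> nat)
            (won : nat -> 'I_m -> 'I_m -> T -> bool),
          (forall i, (1 <= B0 i)%N) ->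
          polya_urn e B0 P B won ->
          {ae P, forall w, exists2 z : 'rV[R]_m,
            J z & proportions R e B0 B w n @[n --> \oo] --> z}
      & ~ balanced_bipartite e -> exists p : 'rV[R]_m, J = [set p] ].
Proof.
have [m_gt0 conn] := connected_e.
exists (equilibria e); split.
- exact: equilibria_interval.
- move=> B0 d T P B won B0_gt0 urn.
  exact: (urn_proportions_cvg simple_e B0_gt0 urn m_gt0).
move=> nb; have [p Jp] := equilibria_nonempty R simple_e m_gt0.
exists p; apply/seteqP; split=> [q Jq|q ->//].
exact: (equilibria_unique simple_e conn nb Jq Jp).
Qed.
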